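(* Let $n>3$ and let $\mathcal{R}=\{r_1,\dots,r_n\}$ be positive real numbers that are pairwise distinct, i.e. $r_i>0$ for all $i$ and $r_i\neq r_j$ for all $i\neq j$. Then there exists a strictly convex configuration of points $V=\{v_1,\dots,v_n\}$ in the plane $\mathbb{R}^2$ with respect to the radii $\mathcal{R}$ (in the sense defined in the context).
   Context: Fix the origin $O\in\mathbb{R}^2$. The radius of a point $v$ is its Euclidean distance $d(O,v)$ from $O$. A polygon is a closed region bounded by a closed chain of segments joining cyclically consecutive vertices; it is simple if the chain does not intersect itself except at the vertices. A simple polygon is convex if it is a convex set, equivalently if every interior angle at a vertex is $\le\pi$ (so listed vertices may be collinear with their neighbours, but the polygon is a genuine two-dimensional region); it is strictly convex if every interior angle at a vertex is $<\pi$. Given positive reals $r_1,\dots,r_n$ (repetitions allowed unless stated otherwise), a (strictly) convex configuration with respect to these radii is a choice of $n$ distinct points $v_1,\dots,v_n\in\mathbb{R}^2$ with $d(O,v_i)=r_i$ for all $i$ which, in some counterclockwise cyclic order, are exactly the vertices of a simple (strictly) convex polygon $P$ with $O\in P$. The cyclic order of the vertices is not prescribed, and edge lengths are free. *)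

(* Defs.v *)
From HB Require Import structures.
From mathcomp Require Import all_boot all_order all_algebra all_fingroup.
From mathcomp Require Import all_classical all_reals all_analysis.

Set Implicit Arguments.
Unset Strict Implicit.
Unset Printing Implicit Defensive.

Import Order.TTheory GRing.Theory Num.Theory.
Import numFieldNormedType.Exports.

Local Open Scope classical_set_scope.
Local Open Scope ring_scope.

(** The plane is ['rV[R]_2], the origin [O] is [0], and a closed chain with [n]
    vertices is a family [p : 'I_n -> 'rV[R]_2] read cyclically, the successor
    and predecessor of an index being [ordS] and [ord_pred]. *)

(** The library norm on ['rV[R]_2] is the sup norm, so the Euclidean distance is
    spelled out; both norms give the same topology and the same bounded sets. *)
Definition edist (R : realType) (x y : 'rV[R]_2) : R :=
  Num.sqrt ((x 0 0 - y 0 0) ^+ 2 + (x 0 1 - y 0 1) ^+ 2).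

Definition radius (R : realType) (x : 'rV[R]_2) : R := edist 0 x.

(** Counterclockwise rotation about the origin by the angle [t]. *)
Definition rotate (R : realType) (t : R) (u : 'rV[R]_2) : 'rV[R]_2 :=
  \row_(j < 2) (if j == 0 then cos t * u 0 0 - sin t * u 0 1
                else sin t * u 0 0 + cos t * u 0 1).

Definition segment (R : realType) (a b : 'rV[R]_2) : set 'rV[R]_2 :=
  [set a + s *: (b - a) | s in `[0, 1]].

Definition edge (R : realType) (n : nat) (p : 'I_n -> 'rV[R]_2) (i : 'I_n) :
  set 'rV[R]_2 := segment (p i) (p (ordS i)).

Definition chain (R : realType) (n : nat) (p : 'I_n -> 'rV[R]_2) :
  set 'rV[R]_2 := \bigcup_i edge p i.

(** Two different edges can meet only if they are cyclically consecutive, and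
    then only at the vertex they share. *)
Definition simple_chain (R : realType) (n : nat) (p : 'I_n -> 'rV[R]_2) : Prop :=
  [/\ (2 < n)%N,
      injective p
    & forall (i j : 'I_n) (x : 'rV[R]_2), i != j -> edge p i x -> edge p j x ->
        (j = ordS i /\ x = p j) \/ (i = ordS j /\ x = p i)].

(** The closed region bounded by the chain: the chain together with the bounded
    connected components of its complement (for a simple chain there is exactly
    one, by the Jordan curve theorem). *)
Definition region (R : realType) (n : nat) (p : 'I_n -> 'rV[R]_2) :
  set 'rV[R]_2 :=
  chain p `|` [set x | (~` chain p) x /\
                       bounded_set (connected_component (~` chain p) x)].

(** The region lies to the left of every edge: from each relative interior point
    of an edge, a small enough move along the left normal stays in the region. *)
Definition counterclockwise (R : realType) (n : nat) (p : 'I_n -> 'rV[R]_2) :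
  Prop :=
  forall (i : 'I_n) (s : R), 0 < s < 1 ->
    let e := p (ordS i) - p i in
    \forall t \near 0^'+, region p (p i + s *: e + t *: rotate (pi / 2) e).

(** [t], taken in [0, 2 pi), is the angle from the direction of [u]
    counterclockwise to the direction of [w]. *)
Definition is_ccw_angle (R : realType) (u w : 'rV[R]_2) (t : R) : Prop :=
  0 <= t < 2 * pi /\ exists2 k : R, 0 < k & w = k *: rotate t u.

(** For a counterclockwise simple chain the region fills, near the vertex [p i],
    the sector swept counterclockwise from the outgoing edge to the incoming
    one. *)
Definition is_interior_angle (R : realType) (n : nat) (p : 'I_n -> 'rV[R]_2)
  (i : 'I_n) (t : R) : Prop :=
  is_ccw_angle (p (ordS i) - p i) (p (ord_pred i) - p i) t.

Definition strictly_convex_polygon (R : realType) (n : nat)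
  (p : 'I_n -> 'rV[R]_2) : Prop :=
  [/\ simple_chain p,
      counterclockwise p
    & forall i : 'I_n, exists2 t : R, is_interior_angle p i t & t < pi].

(** The cyclic order of the vertices is [v (s 0), v (s 1), ...] for some
    permutation [s] of the indices. *)
Definition strictly_convex_configuration (R : realType) (n : nat)
  (r : 'I_n -> R) (v : 'I_n -> 'rV[R]_2) : Prop :=
  [/\ injective v,
      forall i : 'I_n, radius (v i) = r i
    & exists s : {perm 'I_n},
        strictly_convex_polygon (v \o s) /\ region (v \o s) 0].

(* Main.v *)
Require Import Defs.
From mathcomp Require Import all_boot all_order all_algebra all_fingroup.
From mathcomp Require Import all_classical all_reals all_analysis.
From mathcomp Require Import ring lra zify.

(* Let [m] and [M] be the smallest and the largest radius. The circle having the
   segment from [(-m, 0)] to [(M, 0)] as a diameter meets every circle of radius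
   in [[m, M]] about the origin. Placing all vertices on its closed upper half
   gives a polygon inscribed in a circle, hence strictly convex, one edge of which
   is that diameter and so contains the origin. The region bounded by the chain is
   identified through the strict inside of the edges, a bounded open set whose
   closure adds only points of the chain. *)

Set Implicit Arguments.
Unset Strict Implicit.
Unset Printing Implicit Defensive.

Import Order.TTheory GRing.Theory Num.Theory.
Import numFieldNormedType.Exports.
Local Open Scope classical_set_scope.
Local Open Scope ring_scope.

(** * Orientations, cross products and angles *)

Definition cross (R : realType) (u w : 'rV[R]_2) : R :=
  u 0 0 * w 0 1 - u 0 1 * w 0 0.

(** Twice the signed area of the triangle [a b c]: positive when [c] lies strictly to the left of
    the line directed from [a] to [b]. *)
Definition orient (R : realType) (a b c : 'rV[R]_2) : R :=
  cross (b - a) (c - a).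

Lemma rV2P (R : realType) (u w : 'rV[R]_2) :
  u 0 0 = w 0 0 -> u 0 1 = w 0 1 -> u = w.
Proof.
move=> h0 h1; apply/rowP => j.
by case: (boolP (j == 0)) => [/eqP ->//|]; case: j => -[|[|//]] // ? _;
   rewrite (_ : Ordinal _ = 1) //; apply/val_inj.
Qed.

Lemma orientC (R : realType) (a b c : 'rV[R]_2) : orient a b c = orient b c a.
Proof. by rewrite /orient /cross !mxE; ring. Qed.

Lemma orient_l (R : realType) (a b : 'rV[R]_2) : orient a b a = 0.
Proof. by rewrite /orient /cross !mxE; ring. Qed.

Lemma orient_r (R : realType) (a b : 'rV[R]_2) : orient a b b = 0.
Proof. by rewrite /orient /cross !mxE; ring. Qed.

Lemma orient_segment (R : realType) (a b c d : 'rV[R]_2) (s : R) :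
  orient a b (c + s *: (d - c)) = (1 - s) * orient a b c + s * orient a b d.
Proof. by rewrite /orient /cross !mxE; ring. Qed.

Lemma orient_translate (R : realType) (a b c u : 'rV[R]_2) (t : R) :
  orient a b (c + t *: u) = orient a b c + t * cross (b - a) u.
Proof. by rewrite /orient /cross !mxE; ring. Qed.

Lemma orient_eq0P (R : realType) (a b x : 'rV[R]_2) :
  a <> b -> orient a b x = 0 -> exists s, x = a + s *: (b - a).
Proof.
move=> ab; rewrite /orient /cross !mxE => h.
have [e0|e0] := eqVneq (b 0 0 - a 0 0) 0; last first.
  exists ((x 0 0 - a 0 0) / (b 0 0 - a 0 0)).
  apply: rV2P; rewrite !mxE; first by field.
  apply: (mulfI e0); rewrite mulrDr mulrA mulrCA divff// mulr1; lra.
have [e1|e1] := eqVneq (b 0 1 - a 0 1) 0.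
  by exfalso; apply: ab; apply: rV2P; lra.
exists ((x 0 1 - a 0 1) / (b 0 1 - a 0 1)).
apply: rV2P; rewrite !mxE; last by field.
apply: (mulfI e1); rewrite mulrDr mulrA mulrCA divff// mulr1; lra.
Qed.

Lemma continuous_orient (R : realType) (a b : 'rV[R]_2) :
  continuous (orient a b).
Proof.
have h (i : 'I_2) : continuous (fun y : 'rV[R]_2 => (y - a) 0 i).
  move=> x; rewrite (_ : (fun y : 'rV[R]_2 => (y - a) 0 i) =
                         (fun y : 'rV[R]_2 => y 0 i - a 0 i)).
    exact: (cvgB (@coord_continuous R 1 2 0 i x) (cvg_cst _)).
  by apply/funext => y; rewrite !mxE.
move=> x; rewrite /orient /cross.
exact: (cvgB (cvgM (cvg_cst _) (h 1 x)) (cvgM (cvg_cst _) (h 0 x))).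
Qed.

(** The angle is the arccosine of the normalized dot product. The sign of the cross product is that
    of the sine, so a positive one selects the branch of [acos], with values below [pi]. *)
Lemma ccw_angle_lt_pi (R : realType) (u w : 'rV[R]_2) :
  0 < cross u w -> exists2 t : R, is_ccw_angle u w t & t < pi.
Proof.
rewrite /is_ccw_angle /cross => h.
set a := u 0 0 in h *; set b := u 0 1 in h *.
set c := w 0 0 in h *; set d := w 0 1 in h *.
have abs0 : 0 < a ^+ 2 + b ^+ 2.
  rewrite lt_neqAle addr_ge0 ?sqr_ge0// andbT eq_sym paddr_eq0 ?sqr_ge0//.
  rewrite !sqrf_eq0; apply/negP => /andP[/eqP ha /eqP hb].
  by move: h; rewrite ha hb !mul0r subr0 ltxx.
have cds0 : 0 < c ^+ 2 + d ^+ 2.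
  rewrite lt_neqAle addr_ge0 ?sqr_ge0// andbT eq_sym paddr_eq0 ?sqr_ge0//.
  rewrite !sqrf_eq0; apply/negP => /andP[/eqP ha /eqP hb].
  by move: h; rewrite ha hb !mulr0 subr0 ltxx.
set N := Num.sqrt (a ^+ 2 + b ^+ 2); set M := Num.sqrt (c ^+ 2 + d ^+ 2).
have N0 : 0 < N by rewrite sqrtr_gt0.
have M0 : 0 < M by rewrite sqrtr_gt0.
have NN : N ^+ 2 = a ^+ 2 + b ^+ 2 by rewrite sqr_sqrtr ?ltW.
have MM : M ^+ 2 = c ^+ 2 + d ^+ 2 by rewrite sqr_sqrtr ?ltW.
have N0' := lt0r_neq0 N0; have M0' := lt0r_neq0 M0.
pose co := (a * c + b * d) / (N * M).
pose si := (a * d - b * c) / (N * M).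
(* Lagrange's identity: the squares of the dot and cross products add up to the product of the
   squared lengths. *)
have cosi : co ^+ 2 + si ^+ 2 = 1.
  have -> : co ^+ 2 + si ^+ 2 =
    ((a ^+ 2 + b ^+ 2) * (c ^+ 2 + d ^+ 2)) / (N ^+ 2 * M ^+ 2).
    by rewrite /co /si; field; rewrite N0' M0'.
  by rewrite NN MM divff// mulf_neq0 ?lt0r_neq0.
have si0 : 0 < si by rewrite divr_gt0 ?mulr_gt0.
have co1 : -1 < co < 1 by apply/andP; split; nra.
have co1' : -1 <= co <= 1 by lra.
exists (acos co); last by apply: acos_ltpi; lra.
have Ecos : cos (acos co) = co by apply: acosK; rewrite in_itv.
have Esin : sin (acos co) = si.
  by rewrite sin_acos// (_ : 1 - co ^+ 2 = si ^+ 2) ?sqrtr_sqr ?gtr0_norm//; lra.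
split.
  rewrite acos_ge0//=; apply: (le_lt_trans (acos_lepi co1')).
  by rewrite mulr2n mulrDl !mul1r ltrDl pi_gt0.
exists (M / N); first exact: divr_gt0.
have E1 : co * a - si * b = c * N / M.
  transitivity (c * (a ^+ 2 + b ^+ 2) / (N * M)).
    by rewrite /co /si; field; rewrite N0' M0'.
  by rewrite -NN; field; rewrite N0' M0'.
have E2 : si * a + co * b = d * N / M.
  transitivity (d * (a ^+ 2 + b ^+ 2) / (N * M)).
    by rewrite /co /si; field; rewrite N0' M0'.
  by rewrite -NN; field; rewrite N0' M0'.
apply: rV2P; rewrite !mxE /= Ecos Esin -/a -/b ?E1 ?E2 -/c -/d;
  by field; rewrite N0' M0'.
Qed.

(** * Chains in convex position *)

Lemma val_ordS (n : nat) (i : 'I_n) :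
  (ordS i : nat) = if i.+1 == n then 0%N else i.+1.
Proof.
rewrite /=; case: eqP => [->|ne]; first by rewrite modnn.
by rewrite modn_small// ltn_neqAle ltn_ord andbT; exact/eqP.
Qed.

Lemma ordS_neq (n : nat) (i : 'I_n) : (2 < n)%N ->
  (ordS i != i) * (ordS (ordS i) != i).
Proof.
move=> n2; have ni := ltn_ord i.
by split; apply/eqP => /(congr1 (@nat_of_ord n)); move: (val_ordS i) (val_ordS (ordS i));
  case: ifP => e1 h1; case: ifP => e2 h2; lia.
Qed.

(** Strict convexity and counterclockwise order in one algebraic condition, to be checked on triples
    of vertices only. *)
Definition convex_position (R : realType) (n : nat) (p : 'I_n -> 'rV[R]_2) :=
  forall i j : 'I_n, j != i -> j != ordS i ->
    0 < orient (p i) (p (ordS i)) (p j).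

Definition inside (R : realType) (n : nat) (p : 'I_n -> 'rV[R]_2) :
    set 'rV[R]_2 :=
  [set x | forall i, 0 < orient (p i) (p (ordS i)) x].

Lemma convex_position_ge0 (R : realType) (n : nat) (p : 'I_n -> 'rV[R]_2)
  (i j : 'I_n) :
  convex_position p -> 0 <= orient (p i) (p (ordS i)) (p j).
Proof.
move=> hp; have [->|ji] := eqVneq j i; first by rewrite orient_l.
have [->|ji'] := eqVneq j (ordS i); first by rewrite orient_r.
exact: ltW (hp _ _ _ _).
Qed.

Lemma convex_position_inj (R : realType) (n : nat) (p : 'I_n -> 'rV[R]_2) :
  (2 < n)%N -> convex_position p -> injective p.
Proof.
move=> n2 hp i j pij; apply/eqP; apply: contraT => ij.
have [jS|jS] := eqVneq j (ordS i).
  have := hp i (ordS (ordS i)); rewrite !ordS_neq// => /(_ isT isT).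
  by rewrite -jS -pij /orient /cross !mxE; lra.
have := hp i j; rewrite eq_sym ij => /(_ isT jS).
by rewrite -pij orient_l ltxx.
Qed.

(** A common point of edges [i] and [j] has orientation 0 with respect to edge [i], yet it is a
    convex combination of the nonnegative orientations of the ends of edge [j]. Hence an end of
    positive weight lies on the line of edge [i], so it is an end of edge [i]. *)
Lemma convex_position_simple (R : realType) (n : nat)
  (p : 'I_n -> 'rV[R]_2) :
  (2 < n)%N -> convex_position p -> simple_chain p.
Proof.
move=> n2 hp; split => //; first exact: convex_position_inj.
move=> i j x ij [s _ sx] [t].
rewrite /= in_itv /= => /andP[t0 t1] tx.
have : orient (p i) (p (ordS i)) x = 0.
  by rewrite -sx orient_segment orient_l orient_r !mulr0 addr0.
rewrite -tx orient_segment => /eqP.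
rewrite paddr_eq0 ?mulr_ge0 ?convex_position_ge0 ?subr_ge0// !mulf_eq0.
move=> /andP[hj hSj].
have [jS|jS] := eqVneq j (ordS i).
  left; split => //.
  have h : 0 < orient (p i) (p (ordS i)) (p (ordS j)).
    by apply: hp; rewrite jS ordS_neq.
  move: hSj; rewrite (gt_eqF h) orbF => /eqP ->.
  by rewrite scale0r addr0.
have h : 0 < orient (p i) (p (ordS i)) (p j) by apply: hp; rewrite // eq_sym.
move: hj; rewrite (gt_eqF h) orbF subr_eq0 => /eqP t1E.
move: hSj; rewrite -t1E oner_eq0 /= => hSj.
right; suff iS : i = ordS j by split => //; rewrite iS scale1r addrC subrK.
apply/eqP; apply: contraT => iS.
have h' : 0 < orient (p i) (p (ordS i)) (p (ordS j)).
  apply: hp; first by rewrite eq_sym.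
  by apply: contra ij => /eqP /ordS_inj ->.
by rewrite (gt_eqF h') in hSj.
Qed.

Lemma convex_position_boundary (R : realType) (n : nat)
  (p : 'I_n -> 'rV[R]_2) (i : 'I_n) (x : 'rV[R]_2) :
  (2 < n)%N -> convex_position p ->
  (forall j, 0 <= orient (p j) (p (ordS j)) x) ->
  orient (p i) (p (ordS i)) x = 0 -> edge p i x.
Proof.
move=> n2 hp xge xi0.
have [|s xE] := orient_eq0P _ xi0.
  by move/(convex_position_inj n2 hp)/eqP; rewrite eq_sym (negPf (ordS_neq i n2).1).
exists s => //=; rewrite in_itv /=; apply/andP; split.
  (* On the line of edge [i], the preceding edge forces [0 <= s] and the following one [s <= 1]. *)
  set k := ord_pred i; have kS : ordS k = i by rewrite ord_predK.
  have := xge k; rewrite xE orient_segment kS orient_r mulr0 add0r.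
  rewrite pmulr_lge0//; rewrite -kS; apply: hp; rewrite ordS_neq//.
have := xge (ordS i); rewrite xE orient_segment orient_l mulr0 addr0.
rewrite pmulr_lge0 ?subr_ge0//; apply: hp.
  by rewrite eq_sym ordS_neq.
by rewrite eq_sym ordS_neq.
Qed.

(** * The region bounded by the chain *)

(** The terms linear in the point cancel around the cycle; what remains is the shoelace formula for
    twice the signed area. *)
Lemma sum_orient (R : realType) (n : nat) (p : 'I_n -> 'rV[R]_2)
  (x y : 'rV[R]_2) :
  \sum_i orient (p i) (p (ordS i)) x = \sum_i orient (p i) (p (ordS i)) y.
Proof.
have rot z : \sum_i cross (p (ordS i)) z = \sum_i cross (p i) z.
  by rewrite [RHS](reindex_inj (@ordS_inj n)).
suff sumE z : \sum_i orient (p i) (p (ordS i)) z =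
    \sum_i cross (p i) (p (ordS i)) by rewrite !sumE.
have e i : orient (p i) (p (ordS i)) z =
    cross (p (ordS i)) z - cross (p i) z + cross (p i) (p (ordS i)).
  by rewrite /orient /cross !mxE; ring.
by under eq_bigr do rewrite e; rewrite big_split /= sumrB rot subrr add0r.
Qed.

(* The sum of all [orient (p i) (p (ordS i)) x] does not depend on [x], so each
   of these positive terms is bounded; two of them determine [x]. *)
Lemma bounded_inside (R : realType) (n : nat) (p : 'I_n -> 'rV[R]_2) :
  (2 < n)%N -> convex_position p -> bounded_set (inside p).
Proof.
move=> n2 hp; have n0 : (0 < n)%N by apply: leq_trans n2.
set i := Ordinal n0; set A := \sum_i orient (p i) (p (ordS i)) 0.
have bnd x j : inside p x -> 0 < orient (p j) (p (ordS j)) x <= A.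
  move=> xU; rewrite xU /= /A -(sum_orient p x) (bigD1 j)//= lerDl.
  by apply: sumr_ge0 => k _; exact: ltW.
set u := p (ordS i) - p i; set w := p (ordS (ordS i)) - p (ordS i).
have D0 : 0 < cross u w.
  have := hp i (ordS (ordS i)); rewrite !ordS_neq// => /(_ isT isT).
  by rewrite /u /w /orient /cross !mxE; lra.
pose B := A + `|cross u (p i)| + `|cross w (p (ordS i))|.
pose C := `|u 0 0| + `|u 0 1| + `|w 0 0| + `|w 0 1|.
have xB x : inside p x -> forall j : 'I_2, `|x 0 j| <= B * C / cross u w.
  move=> xU j.
  have hu : `|cross u x| <= B.
    have := bnd _ i xU.
    rewrite (_ : orient _ _ _ = cross u x - cross u (p i)); last first.
      by rewrite /orient /u /cross !mxE; ring.
    have := normr_ge0 (cross w (p (ordS i))).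
    rewrite /B; have := ler_norm (cross u (p i)).
    have := ler_norm (- cross u (p i)); rewrite normrN.
    by rewrite ler_norml; lra.
  have hw : `|cross w x| <= B.
    have := bnd _ (ordS i) xU.
    rewrite (_ : orient _ _ _ = cross w x - cross w (p (ordS i))); last first.
      by rewrite /orient /w /cross !mxE; ring.
    have := normr_ge0 (cross u (p i)).
    rewrite /B; have := ler_norm (cross w (p (ordS i))).
    have := ler_norm (- cross w (p (ordS i))); rewrite normrN.
    by rewrite ler_norml; lra.
  (* Cramer's rule for the independent directions [u] and [w] of two consecutive edges. *)
  have -> : x 0 j = (cross u x * w 0 j - cross w x * u 0 j) / cross u w.
    apply: (mulIf (lt0r_neq0 D0)); rewrite divfK ?lt0r_neq0//.
    have [->|] := eqVneq j 0; first by rewrite /cross; ring.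
    case: j => -[|[|//]] // ? _.
    by rewrite (_ : Ordinal _ = 1); [rewrite /cross; ring|exact/val_inj].
  have D0' : 0 < (cross u w)^-1 by rewrite invr_gt0.
  rewrite normrM (gtr0_norm D0') ler_pM2r//.
  apply: (le_trans (ler_normB _ _)); rewrite !normrM.
  have uj : `|u 0 j| + `|w 0 j| <= C.
    rewrite /C; have := normr_ge0 (u 0 0); have := normr_ge0 (u 0 1).
    have := normr_ge0 (w 0 0); have := normr_ge0 (w 0 1).
    have [->|] := eqVneq j 0; first by lra.
    case: j => -[|[|//]] // ? _.
    by rewrite (_ : Ordinal _ = 1); [lra|exact/val_inj].
  apply: (@le_trans _ _ (B * (`|u 0 j| + `|w 0 j|))).
    by rewrite mulrDr addrC lerD// ler_wpM2r.
  by rewrite ler_wpM2l// (le_trans _ hu).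
(* The maximum with 0 covers the initial value of the big maximum defining the sup norm. *)
exists (Num.max 0 (B * C / cross u w)); split; first exact: num_real.
move=> M; rewrite gt_max => /andP[M0 hM] x xU /=.
rewrite [X in X <= _]mx_normrE; apply: bigmax_le; first exact: ltW.
by move=> [k j] _ /=; rewrite ord1; apply: le_trans (xB _ xU j) (ltW hM).
Qed.

Lemma chain_not_inside (R : realType) (n : nat) (p : 'I_n -> 'rV[R]_2)
  (x : 'rV[R]_2) : inside p x -> ~ chain p x.
Proof.
move=> xU [i _ [s _ sx]]; have := xU i.
by rewrite -sx orient_segment orient_l orient_r !mulr0 addr0 ltxx.
Qed.

(** In the component of [x] off the chain, [inside p] is nonempty, relatively open and relatively
    closed, so it is the whole component, which is therefore bounded. *)
Lemma inside_region (R : realType) (n : nat) (p : 'I_n -> 'rV[R]_2)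
  (x : 'rV[R]_2) :
  (2 < n)%N -> convex_position p -> inside p x -> region p x.
Proof.
move=> n2 hp xU; right; have xC := chain_not_inside xU; split => //.
set C := connected_component _ _.
suff CU : (C `<=` inside p).
  have [M [Mreal hM]] := bounded_inside n2 hp.
  by exists M; split=> // N MN y /CU; exact: hM.
(* [K] replaces the strict inequalities by weak ones; by [convex_position_boundary] this adds only
   points of the chain. *)
pose K : set 'rV[R]_2 :=
  (\bigcap_(i in [set: 'I_n]) [set y | 0 <= orient (p i) (p (ordS i)) y]).
have UK : (C `&` inside p = C `&` K).
  apply/seteqP; split=> y [Cy yU]; split => //.
    by move=> i _; exact/ltW/yU.
  move=> i; rewrite lt_neqAle (yU i I) andbT; apply/eqP => /esym y0.
  apply: (connected_component_sub Cy); exists i => //.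
  by apply: convex_position_boundary => // j; exact: yU.
suff <- : (C `&` inside p = C) by move=> y [].
apply: (@component_connected _ (~` chain p) x).
- by exists x; split => //; exact: connected_component_refl.
- exists (inside p) => //; rewrite openE => y yU.
  apply: (@filter_forall _ _ _ (nbhs y)) => i.
  have : open [set t : R | 0 < t] by exact: open_gt.
  move=> /(open_comp (f := orient (p i) (p (ordS i)))).
  by rewrite openE; apply => [z _|]; [exact: continuous_orient|exact: yU].
- exists K => //; apply: closed_bigI => i _.
  apply: (@preimage_closed _ _ (orient (p i) (p (ordS i))) [set t : R | 0 <= t]).
    by move=> z _; exact: continuous_orient.
  exact: closed_ge.
Qed.

(** Along the left normal each orientation is affine in [t]. For the edge itself it starts at 0 with
    slope the squared length of [e]; for any other edge it starts positive. *)
Lemma convex_position_ccw (R : realType) (n : nat) (p : 'I_n -> 'rV[R]_2) :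
  (2 < n)%N -> convex_position p -> counterclockwise p.
Proof.
move=> n2 hp i s /andP[s0 s1] /=; set e := _ - _.
have : \forall t \near 0^'+, forall j,
    0 < orient (p j) (p (ordS j)) (p i + s *: e + t *: rotate (pi / 2) e).
  apply: filter_forall => j; under eq_near do rewrite orient_translate.
  rewrite orient_segment; set a := _ + _; set b := cross _ _.
  have [jE|ji] := eqVneq j i.
    have a0 : a = 0 by rewrite /a jE orient_l orient_r !mulr0 addr0.
    have b0 : 0 < b.
      have -> : b = e 0 0 ^+ 2 + e 0 1 ^+ 2.
        rewrite /b jE -/e /cross /rotate !mxE /= cos_pihalf sin_pihalf; ring.
      rewrite lt_neqAle addr_ge0 ?sqr_ge0// andbT eq_sym paddr_eq0 ?sqr_ge0//.
      rewrite !sqrf_eq0; apply/negP => /andP[/eqP h0 /eqP h1].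
      have : p (ordS i) = p i.
        by apply: rV2P; move: h0 h1; rewrite /e !mxE => *; lra.
      by move/(convex_position_inj n2 hp)/eqP; rewrite (negPf (ordS_neq i n2).1).
    near=> t; rewrite a0 add0r mulr_gt0//; near: t; exact: nbhs_right_gt.
  have a0 : 0 < a.
    rewrite /a; have [jS|jS] := eqVneq j (ordS i).
      rewrite ltr_wpDr ?mulr_ge0 ?convex_position_ge0 ?(ltW s0)//.
      apply: mulr_gt0; first by rewrite subr_gt0.
      by rewrite jS; apply: hp; rewrite eq_sym ordS_neq.
    have [iS|iS] := eqVneq i (ordS j).
      rewrite ltr_wpDl ?mulr_ge0 ?convex_position_ge0 ?subr_ge0 ?(ltW s1)//.
      apply: mulr_gt0 => //; apply: hp; first by rewrite eq_sym.
      by rewrite -iS ordS_neq.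
    rewrite ltr_wpDr ?mulr_ge0 ?convex_position_ge0 ?(ltW s0)//.
    apply: mulr_gt0; first by rewrite subr_gt0.
    by apply: hp; rewrite // eq_sym.
  (* Adding 1 keeps the denominator positive even when the slope [b] is 0. *)
  have b1 : 0 < `|b| + 1 by rewrite ltr_wpDl.
  have c0 : 0 < a / (`|b| + 1) by exact: divr_gt0.
  near=> t.
  have t0 : 0 < t by near: t; exact: nbhs_right_gt.
  have : t < a / (`|b| + 1) by near: t; exact: nbhs_right_lt.
  rewrite ltr_pdivlMr// => ht.
  have := ler_norm (- b); rewrite normrN => hb.
  have : t * - b <= t * `|b| by rewrite ler_pM2l.
  rewrite mulrN; nra.
by apply: filterS => t ht; exact: inside_region.
Unshelve. all: by end_near.
Qed.

Lemma convex_position_strictly_convex (R : realType) (n : nat)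
  (p : 'I_n -> 'rV[R]_2) :
  (2 < n)%N -> convex_position p -> strictly_convex_polygon p.
Proof.
move=> n2 hp; split.
- exact: convex_position_simple.
- exact: convex_position_ccw.
(* The cross product of the two edge vectors at [p i] is the orientation of the predecessor with
   respect to the outgoing edge. *)
move=> i; apply: ccw_angle_lt_pi; apply: hp.
  by rewrite -{2}(ord_predK i) eq_sym ordS_neq.
by rewrite -{2}(ord_predK i) eq_sym ordS_neq.
Qed.

(** * Points on the half circle *)

(* The abscissa comes from intersecting the circle of radius [r] about the origin
   with the circle having the segment from [(-m, 0)] to [(M, 0)] as a diameter. *)
Definition circle_point (R : realType) (m M r : R) : 'rV[R]_2 :=
  let x := (r ^+ 2 - m * M) / (M - m) in
  \row_(j < 2) (if j == 0 then x else Num.sqrt ((x + m) * (M - x))).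

Lemma circle_pointP (R : realType) (m M r : R) : 0 < m < M -> m <= r <= M ->
  let x := circle_point m M r 0 0 in let y := circle_point m M r 0 1 in
  [/\ x * (M - m) = r ^+ 2 - m * M, 0 <= y & y ^+ 2 = (x + m) * (M - x)].
Proof.
move=> /andP[m0 mM] /andP[mr rM]; rewrite /= !mxE /=.
set x := _ / _; have d0 : 0 < M - m by rewrite subr_gt0.
have xE : x * (M - m) = r ^+ 2 - m * M by rewrite divfK ?lt0r_neq0.
split => //; rewrite sqr_sqrtr// mulr_ge0//.
  (* Multiplied by [M - m], the two factors become [r ^+ 2 - m ^+ 2] and [M ^+ 2 - r ^+ 2]. *)
  by rewrite -(pmulr_lge0 _ d0) mulrDl xE; nra.
by rewrite -(pmulr_lge0 _ d0) mulrBl xE; nra.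
Qed.

Lemma radius_circle_point (R : realType) (m M r : R) : 0 < m < M ->
  m <= r <= M -> Defs.radius (circle_point m M r) = r.
Proof.
move=> hmM hr; have [xE _ yE] := circle_pointP hmM hr.
rewrite /Defs.radius /Defs.edist [(0 : 'rV__) 0 0]mxE [(0 : 'rV__) 0 1]mxE.
rewrite !sub0r !sqrrN yE (_ : _ + _ = r ^+ 2); last by lra.
by rewrite sqrtr_sqr ger0_norm//; lra.
Qed.

(** The abscissa increases with the radius, so decreasing radii run from right to left along the
    upper half circle, and the claim is its strict concavity. *)
Lemma orient_circle_point (R : realType) (m M a b c : R) : 0 < m < M ->
  m <= c -> c < b -> b < a -> a <= M ->
  0 < orient (circle_point m M a) (circle_point m M b) (circle_point m M c).
Proof.
move=> hmM mc cb ba aM; have /andP[m0 mM] := hmM.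
have [|xa ya ya2] := @circle_pointP R m M a hmM; first by lra.
have [|xb yb yb2] := @circle_pointP R m M b hmM; first by lra.
have [|xc yc yc2] := @circle_pointP R m M c hmM; first by lra.
move: xa ya ya2 xb yb yb2 xc yc yc2.
move: (circle_point _ _ a) (circle_point _ _ b) (circle_point _ _ c).
move=> A B C; rewrite /orient /cross !mxE /=.
move: (A 0 0) (A 0 1) (B 0 0) (B 0 1) (C 0 0) (C 0 1).
move=> xa ya xb yb xc yc xaE ya0 ya2 xbE yb0 yb2 xcE yc0 yc2.
have d0 : 0 < M - m by lra.
have xba : xb < xa by rewrite -(ltr_pM2r d0) xaE xbE; nra.
have xcb : xc < xb by rewrite -(ltr_pM2r d0) xbE xcE; nra.
set l := xb - xc; set k := xa - xb.
have l0 : 0 < l by rewrite subr_gt0.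
have k0 : 0 < k by rewrite subr_gt0.
(* [xb] is the mean of [xa] and [xc] with weights [l] and [k], so this says that the middle point
   lies above the chord. Both sides are nonnegative and can be squared. *)
suff : l * ya + k * yc < (l + k) * yb by rewrite /l /k; lra.
have lo : 0 <= l * ya + k * yc.
  by apply: addr_ge0; apply: mulr_ge0 => //; exact: ltW.
have hi : 0 <= (l + k) * yb by apply: mulr_ge0 => //; exact/ltW/addr_gt0.
suff : (l * ya + k * yc) ^+ 2 < ((l + k) * yb) ^+ 2.
  by rewrite ltr_pXn2r// nnegrE.
rewrite -subr_gt0.
have -> : ((l + k) * yb) ^+ 2 - (l * ya + k * yc) ^+ 2 =
    l * k * (l + k) ^+ 2 + l * k * (ya - yc) ^+ 2.
  transitivity ((l + k) ^+ 2 * yb ^+ 2 - (l + k) * (l * ya ^+ 2 + k * yc ^+ 2)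
    + l * k * (ya - yc) ^+ 2); first by ring.
  by rewrite yb2 ya2 yc2 /l /k; ring.
have lk := mulr_gt0 l0 k0.
apply: ltr_wpDr; first exact: mulr_ge0 (ltW lk) (sqr_ge0 _).
exact: mulr_gt0 lk (exprn_gt0 _ (addr_gt0 l0 k0)).
Qed.

(** * Sorting the radii and assembling the configuration *)

Lemma decreasing_perm (R : realType) (n : nat) (r : 'I_n -> R) :
  injective r ->
  exists s : {perm 'I_n}, forall i j : 'I_n, (i < j)%N -> r (s j) < r (s i).
Proof.
move=> rinj; pose t := [tuple r i | i < n].
have /tuple_permP[s sE] : perm_eq (sort >=%O t) t by rewrite perm_sort.
exists s => i j ij; rewrite lt_neqAle (inj_eq rinj) (inj_eq perm_inj).
rewrite -val_eqE neq_ltn ij orbT /=.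
have hn (k : 'I_n) : nth 0 (sort >=%O t) k = r (s k) :> R.
  by rewrite sE -[LHS](tnth_nth 0 _ k) !tnth_mktuple.
rewrite -!hn.
have srt : sorted >=%O (sort >=%O t).
  by apply: sort_sorted => x y; exact: le_total.
have getr : transitive (>=%O : rel R) by move=> x y z /[swap]; exact: le_trans.
have si (k : 'I_n) : (k : nat) \in [pred l | (l < size (sort >=%O t))%N].
  by rewrite inE size_sort size_tuple.
exact: (sorted_ltn_nth getr 0 srt _ _ (si i) (si j) ij).
Qed.

Theorem theorem1 (R : realType) (n : nat) (r : 'I_n -> R)
  (hn : (3 < n)%N)
  (hpos : forall i : 'I_n, 0 < r i)
  (hdistinct : forall i j : 'I_n, i != j -> r i != r j) :
  exists v : 'I_n -> 'rV[R]_2, strictly_convex_configuration r v.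
Proof.
have rinj : injective r.
  by move=> i j rij; apply/eqP; apply: contraT => /hdistinct; rewrite rij eqxx.
have [s sdec] := decreasing_perm rinj.
have n0 : (0 < n)%N by lia.
have n1 : (n.-1 < n)%N by lia.
pose M := r (s (Ordinal n0)); pose m := r (s (Ordinal n1)).
have mM : 0 < m < M by rewrite hpos sdec//=; lia.
have rs i : m <= r (s i) <= M.
  have [] := (ltnP 0 i, ltnP i n.-1) => -[i0|i0] [i1|i1]; have := ltn_ord i.
  - by rewrite !ltW// sdec.
  - move=> ni; have -> : i = Ordinal n1 by apply/val_inj => /=; lia.
    by rewrite lexx ltW//; case/andP: mM.
  - move=> ni; have -> : i = Ordinal n0 by apply/val_inj => /=; lia.
    by rewrite lexx ltW//; case/andP: mM.
  - by lia.
have hr i : m <= r i <= M by rewrite -(permKV s i).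
pose v i := circle_point m M (r i).
have vr i : Defs.radius (v i) = r i by exact: radius_circle_point.
exists v; split => //.
  by move=> i j vij; apply: rinj; rewrite -!vr vij.
exists s; split.
  apply: convex_position_strictly_convex; first by lia.
  have tri (i j k : 'I_n) : (i < j)%N -> (j < k)%N ->
      0 < orient (v (s i)) (v (s j)) (v (s k)).
    move=> ij jk; apply: orient_circle_point => //; try exact: sdec.
      by have /andP[] := hr (s k).
    by have /andP[] := hr (s i).
  (* A cyclic shift of the triple puts its indices in increasing order, whether edge [i] closes the
     chain, [j] precedes it or [j] follows it. *)
  move=> i j ji jS /=.
  have iS := val_ordS i; have ni := ltn_ord i; have nj := ltn_ord j.
  have {}ji : (j : nat) != i by rewrite val_eqE.
  have {}jS : (j : nat) != ordS i by rewrite val_eqE.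
  have [iE|iE] := eqVneq i.+1 n.
    rewrite iE eqxx in iS; rewrite orientC; apply: tri; lia.
  rewrite (negPf iE) in iS.
  have [lt_ji|ge_ji] := ltnP j i; first by rewrite -orientC; apply: tri; lia.
  by apply: tri; lia.
(* The closing edge runs from [(-m, 0)] to [(M, 0)] and passes through the origin at parameter
   [m / (M + m)]. *)
left; exists (Ordinal n1) => //.
have SE : ordS (Ordinal n1) = Ordinal n0.
  by apply/val_inj; rewrite /= prednK// modnn.
exists (m / (M + m)).
  rewrite /= in_itv /= divr_ge0 ?ler_pdivrMr/=; lra.
have d0 : M - m != 0 by rewrite lt0r_neq0//; lra.
have s0 : M + m != 0 by rewrite lt0r_neq0//; lra.
have xm : (m ^+ 2 - m * M) / (M - m) = - m by field.
have xM : (M ^+ 2 - m * M) / (M - m) = M by field.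
rewrite SE /v /= -/m -/M; apply: rV2P; rewrite !mxE /= xm xM; first by field.
by rewrite addNr subrr mul0r mulr0 sqrtr0 subrr mulr0 addr0.
Qed.
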